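(* For every $z\ge1$, $\mathrm{TD}(\mathrm{QR}^z_{\infty,1,cf})=\mathrm{PBTD}(\mathrm{QR}^z_{\infty,1,cf})=0$. Moreover, if $m\ge2$ and $z=|\Sigma|\ge4m^2+1$, then $\mathrm{PBTD}(\mathrm{QR}^z_{\infty,m,cf})=1$.
   Context: Fix a countably infinite set $X$ of variables and an alphabet $\Sigma$ (finite or countably infinite, disjoint from $X$), $z=|\Sigma|$. A pattern is a nonempty finite string over $X\cup\Sigma$; it is constant-free if it contains no letters of $\Sigma$. A substitution is a morphism $h:(X\cup\Sigma)^*\to\Sigma^*$ fixing letters; $L(\pi)$ (erasing pattern language) is the set of all $h(\pi)$; patterns with equal languages are identified. A pattern is $m$-quasi-regular if every variable occurring in it occurs exactly $m$ times; $\mathrm{QR}^z_{\infty,m,cf}$ is the class of constant-free $m$-quasi-regular patterns over an alphabet of size $z$. A labelled example is $(w,\pm)$ with $w\in\Sigma^*$; a teaching set for $\pi$ w.r.t. a class $\Pi$ is a set $T$ of labelled examples consistent with $\pi$ such that every $\tau\in\Pi$ consistent with $T$ has $L(\tau)=L(\pi)$; $\mathrm{TD}(\pi,\Pi)$ is its minimum size and $\mathrm{TD}(\Pi)=\sup_\pi\mathrm{TD}(\pi,\Pi)$. For a strict partial order $\prec$ on $\Pi$, a teaching set for $\pi$ w.r.t. $(\Pi,\prec)$ is a teaching set for $\pi$ w.r.t. $\Pi\setminus\{\pi':\pi'\prec\pi\}$; $\mathrm{PBTD}(\Pi,\prec)$ is the supremum over $\pi$ of the minimum size of such sets, and $\mathrm{PBTD}(\Pi)=\inf_\prec\mathrm{PBTD}(\Pi,\prec)$.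 *)

(* Defs.v *)
From mathcomp Require Import all_boot.
Set Implicit Arguments. Unset Strict Implicit. Unset Printing Implicit Defensive.

Section Patterns.
Variable Sigma : countType.

(* Variables X = nat; a pattern is a finite string over X + Sigma. *)
Definition pattern := seq (nat + Sigma)%type.
Definition word := seq Sigma.

Definition is_var (s : nat + Sigma) : bool := if s is inl _ then true else false.

Definition subst (h : nat -> word) (p : pattern) : word :=
  flatten (map (fun s => match s with inl x => h x | inr a => [:: a] end) p).

Definition inL (p : pattern) (w : word) : Prop := exists h : nat -> word, w = subst h p.

Definition same_lang (p q : pattern) : Prop := forall w, inL p w <-> inL q w.

Definition constant_free (p : pattern) : bool := all is_var p.

Definition quasi_regular (m : nat) (p : pattern) : bool :=
  all (fun s => is_var s ==> (count_mem s p == m)) p.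

Definition QRcf (m : nat) (p : pattern) : Prop :=
  [/\ p != [::], constant_free p & quasi_regular m p].

Definition example := (word * bool)%type.

Definition consistent (p : pattern) (T : seq example) : Prop :=
  forall e, e \in T -> (inL p e.1 <-> e.2 = true).

Definition teaching_set (Pi : pattern -> Prop) (p : pattern) (T : seq example) : Prop :=
  consistent p T /\ (forall t, Pi t -> consistent t T -> same_lang t p).

(* TD(Pi) <= d  (TD(Pi) is the sup over p in Pi of the minimal size) *)
Definition TD_le (Pi : pattern -> Prop) (d : nat) : Prop :=
  forall p, Pi p -> exists T, size T <= d /\ teaching_set Pi p T.

Definition TD_eq (Pi : pattern -> Prop) (d : nat) : Prop :=
  TD_le Pi d /\ forall d', d' < d -> ~ TD_le Pi d'.

(* strict partial order on Pi, where patterns with equal languages are identified *)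
Definition strict_order_on (Pi : pattern -> Prop) (prec : pattern -> pattern -> Prop) : Prop :=
  [/\ forall p, Pi p -> ~ prec p p,
      forall p q r, Pi p -> Pi q -> Pi r -> prec p q -> prec q r -> prec p r
    & forall p p' q q', same_lang p p' -> same_lang q q' -> prec p q -> prec p' q'].

Definition PBTD_ord_le (Pi : pattern -> Prop) (prec : pattern -> pattern -> Prop) (d : nat) : Prop :=
  forall p, Pi p -> exists T, size T <= d /\
    teaching_set (fun t => Pi t /\ ~ prec t p) p T.

(* PBTD(Pi) = inf over strict orders; <= d iff some order achieves <= d *)
Definition PBTD_le (Pi : pattern -> Prop) (d : nat) : Prop :=
  exists prec, strict_order_on Pi prec /\ PBTD_ord_le Pi prec d.

Definition PBTD_eq (Pi : pattern -> Prop) (d : nat) : Prop :=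
  PBTD_le Pi d /\ forall d', d' < d -> ~ PBTD_le Pi d'.

End Patterns.

(* Main.v *)
Require Import Defs.
From Stdlib Require Import Classical.
From mathcomp Require Import all_boot.

(** Let [t] precede [p] when the language of [t] needs longer patterns of the
class than that of [p]. A pattern [q] of minimal length for its language is then
taught by the single positive example obtained from [q] by replacing each
variable with a word made of more than [size q] blocks [b^e a], all exponents
being distinct. If that word lies in the language of [r] with
[size r <= size q], the factorisation according to [r] cuts at most one block
per letter of [r], so each variable of [q] keeps a block that is never cut;
reading off these blocks gives a morphism [f] mapping [r] to [q]. As all
variables occur [m] times in [q] and in [r], the images of distinct variables of
[r] are duplicate-free and disjoint. Hence [f] has a retraction once the
variables with empty image are erased from [r]; by minimality of [q] there are
none, and [r] and [q] have the same language. *)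

Set Implicit Arguments.
Unset Strict Implicit.
Unset Printing Implicit Defensive.

Lemma ex_argmin (T : Type) (P : T -> Prop) (f : T -> nat) :
  (exists x, P x) -> exists2 x, P x & forall y, P y -> f x <= f y.
Proof.
case=> x; have [n] := ubnP (f x); elim: n x => // n IHn x lt_fx Px.
have [[y [Py lt_fyx]]|no_smaller] := classic (exists y, P y /\ f y < f x).
  by apply: IHn Py; apply: leq_trans lt_fyx _.
exists x => // y Py; rewrite leqNgt; apply/negP => lt_fyx.
by apply: no_smaller; exists y.
Qed.

Definition flat_map T U (f : T -> seq U) (s : seq T) : seq U :=
  flatten [seq f x | x <- s].

Section FlatMap.

Variables T U : Type.
Implicit Types (f : T -> seq U) (s : seq T).

Lemma flat_map_cons f x s : flat_map f (x :: s) = f x ++ flat_map f s.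
Proof. by []. Qed.

Lemma flat_map_cat f s t : flat_map f (s ++ t) = flat_map f s ++ flat_map f t.
Proof. by rewrite /flat_map map_cat flatten_cat. Qed.

Lemma filter_flat_map (P : pred U) f s :
  filter P (flat_map f s) = flat_map (fun x => filter P (f x)) s.
Proof. by rewrite /flat_map filter_flatten -map_comp. Qed.

Lemma flat_map_flatten_nseq f n s :
  flat_map f (flatten (nseq n s)) = flatten (nseq n (flat_map f s)).
Proof. by elim: n => //= n IHn; rewrite flat_map_cat IHn. Qed.

Lemma flat_map_if (P : pred T) (u : seq U) s :
  flat_map (fun x => if P x then u else [::]) s = flatten (nseq (count P s) u).
Proof.
by elim: s => // x s; rewrite flat_map_cons => ->; rewrite /=; case: (P x).
Qed.

Lemma flat_map_filter_nilp f s :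
  flat_map f [seq x <- s | ~~ nilp (f x)] = flat_map f s.
Proof.
elim: s => //= x s IHs; rewrite flat_map_cons -IHs.
by case: nilP => [->|_]; rewrite ?flat_map_cons.
Qed.

End FlatMap.

Lemma flat_map_comp T U V (f : T -> seq U) (g : U -> seq V) s :
  flat_map g (flat_map f s) = flat_map (fun x => flat_map g (f x)) s.
Proof. by elim: s => // x s IHs; rewrite !flat_map_cons flat_map_cat IHs. Qed.

Lemma map_flat_map T U V (f : T -> seq U) (g : U -> V) s :
  map g (flat_map f s) = flat_map (fun x => map g (f x)) s.
Proof. by rewrite /flat_map map_flatten -map_comp. Qed.

Lemma eq_in_flat_map (T : eqType) U (f g : T -> seq U) s :
  {in s, f =1 g} -> flat_map f s = flat_map g s.
Proof. by move=> /eq_in_map fg; rewrite /flat_map fg. Qed.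

Lemma flat_map_seq1_in (T : eqType) (f : T -> seq T) s :
  {in s, forall x, f x = [:: x]} -> flat_map f s = s.
Proof. by move=> /eq_in_flat_map ->; apply: flatten_seq1. Qed.

Lemma uniq_flat_map_retraction (T U : eqType) (f : T -> seq U) s :
    uniq (flat_map f s) -> {in s, forall y, ~~ nilp (f y)} ->
  exists g, {in s, forall y, flat_map g (f y) = [:: y]}.
Proof.
elim: s => [|y s IHs]; first by exists (fun=> [::]).
rewrite flat_map_cons cat_uniq => /and3P [uniq_fy disj uniq_s] f_neq0.
have [|g gE] := IHs uniq_s.
  by move=> z zs; apply: f_neq0; rewrite inE zs orbT.
have [h h_fy] : exists h, h \in f y.
  case: (f y) (f_neq0 y (mem_head _ _)) => // h t _.
  by exists h; apply: mem_head.
pose pick_y x := if pred1 h x then [:: y] else [::].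
exists (fun x => if x \in f y then pick_y x else g x).
move=> z; rewrite inE; case: (eqVneq z y) => [-> _|_ /= zs].
  rewrite (eq_in_flat_map (g := pick_y)) => [|x ->] //.
  by rewrite flat_map_if count_uniq_mem // h_fy.
rewrite -(gE z zs); apply: eq_in_flat_map => x xz; case: ifP => // xy.
by case/hasP: disj; exists x => //; apply/flatten_mapP; exists z.
Qed.

Definition regular (T : eqType) m (s : seq T) :=
  {in s, forall x, count_mem x s = m}.

Section Regular.

Variables (T U : eqType) (m : nat).
Implicit Types s r : seq T.

Lemma regular_perm s : regular m s -> perm_eq s (flatten (nseq m (undup s))).
Proof.
move=> reg_s; apply/allP => x _ /=.
rewrite count_flatten map_nseq sumn_nseq.
rewrite (count_uniq_mem _ (undup_uniq s)) mem_undup.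
by case: (boolP (x \in s)) => [/reg_s ->|/count_memPn ->]; rewrite ?mul1n.
Qed.

Lemma regular_filter (P : pred T) s : regular m s -> regular m (filter P s).
Proof.
move=> reg_s x; rewrite mem_filter => /andP [Px /reg_s <-].
by rewrite count_filter; apply: eq_count => y /=; case: eqP => // ->.
Qed.

Lemma regular_nseq (x : T) : regular m (nseq m x).
Proof.
move=> y; rewrite mem_nseq => /andP [_ /eqP ->].
by rewrite count_nseq /= eqxx mul1n.
Qed.

Lemma regular_cat s r :
  ~~ has (mem s) r -> regular m s -> regular m r -> regular m (s ++ r).
Proof.
move=> /hasPn disj reg_s reg_r x; rewrite mem_cat count_cat.
have [xs _|xs /= xr] := boolP (x \in s).
  by rewrite (reg_s x xs) (count_memPn _) ?addn0 //; apply: contraL xs => /disj.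
by rewrite (count_memPn xs) reg_r.
Qed.

Lemma regular_flat_map_uniq (f : T -> seq U) r :
  regular m r -> regular m (flat_map f r) -> uniq (flat_map f (undup r)).
Proof.
move=> reg_r reg_fr; apply: count_mem_uniq => x.
pose u := flat_map f (undup r).
have perm_fr : perm_eq (flat_map f r) (flatten (nseq m u)).
  by rewrite -flat_map_flatten_nseq perm_flatten ?perm_map ?regular_perm.
have count_fr : count_mem x (flat_map f r) = count_mem x u * m.
  by rewrite (permP perm_fr) count_flatten map_nseq sumn_nseq.
case: (boolP (x \in _)) => [x_fu|/count_memPn //].
have x_fr : x \in flat_map f r.
  case/flatten_mapP: x_fu => y; rewrite mem_undup => yr xy.
  by apply/flatten_mapP; exists y.
have m_gt0 : 0 < m by rewrite -(reg_fr x x_fr) -has_count has_pred1.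
by apply/eqP; rewrite -(eqn_pmul2r m_gt0) -count_fr mul1n reg_fr.
Qed.

End Regular.

Section Teaching.

Variables (Sigma : countType) (Pi : pattern Sigma -> Prop).
Implicit Types p q t u : pattern Sigma.

Lemma same_lang_sym p q : same_lang p q -> same_lang q p.
Proof. by move=> pq w; rewrite pq. Qed.

Lemma same_lang_trans p q t : same_lang p q -> same_lang q t -> same_lang p t.
Proof. by move=> pq qt w; rewrite pq. Qed.

Lemma TD_le0 : (forall p q, Pi p -> Pi q -> same_lang p q) -> TD_le Pi 0.
Proof.
move=> same p Pi_p; exists [::]; split=> //; split=> // t Pi_t _.
exact: same.
Qed.

Lemma TD_le_PBTD_le d : TD_le Pi d -> PBTD_le Pi d.
Proof.
move=> TD_d; exists (fun _ _ => False); split; first by split=> [? _ []||].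
move=> p /TD_d [T [size_T [cons_T teach_T]]]; exists T.
by split=> //; split=> // t [Pi_t _]; apply: teach_T.
Qed.

Lemma PBTD_le0_same_lang p q : PBTD_le Pi 0 -> Pi p -> Pi q -> same_lang p q.
Proof.
move=> [prec [[irr trans _] le0]] Pi_p Pi_q; apply: NNPP => not_pq.
have prec_of_diff t u : Pi t -> Pi u -> ~ same_lang t u -> prec t u.
  move=> Pi_t Pi_u not_tu; apply: NNPP => not_prec; apply: not_tu.
  have [T []] := le0 u Pi_u; rewrite leqn0 size_eq0 => /eqP -> [_ teach].
  exact: teach.
apply: (irr p Pi_p); apply: (trans p q p) => //; apply: prec_of_diff => //.
by move=> /same_lang_sym.
Qed.

Definition shortest q :=
  Pi q /\ forall u, Pi u -> same_lang u q -> size q <= size u.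

Definition longer_lang t p :=
  exists2 q, Pi q /\ same_lang q p &
    forall u, Pi u -> same_lang u t -> size q < size u.

Lemma exists_shortest p : Pi p -> exists2 q, shortest q & same_lang q p.
Proof.
move=> Pi_p.
have [|q [Pi_q qp] min_q] := @ex_argmin _ (fun q => Pi q /\ same_lang q p) size.
  by exists p.
exists q => //; split=> // u Pi_u uq.
by apply: min_q; split=> //; apply: same_lang_trans uq qp.
Qed.

Lemma longer_lang_order : strict_order_on Pi longer_lang.
Proof.
split.
- by move=> p _ [q [Pi_q qp] /(_ q Pi_q qp)]; rewrite ltnn.
- move=> p q t _ _ _ [q' [Pi_q' q'q] lt_p] [t' t't lt_q].
  exists t' => // u Pi_u up.
  by apply: ltn_trans (lt_q _ Pi_q' q'q) (lt_p _ Pi_u up).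
- move=> p p' q q' pp' qq' [t [Pi_t tq] lt_p].
  exists t; first by split=> //; apply: same_lang_trans tq qq'.
  move=> u Pi_u up'; apply: lt_p => //.
  by apply: same_lang_trans up' _; apply: same_lang_sym.
Qed.

Lemma PBTD_le1_shortest :
    (forall q, shortest q -> exists2 w, inL q w &
       forall t, Pi t -> size t <= size q -> inL t w -> same_lang t q) ->
  PBTD_le Pi 1.
Proof.
move=> char_word; exists longer_lang.
split=> [|p Pi_p]; first exact: longer_lang_order.
have [q short_q qp] := exists_shortest Pi_p.
have [w qw w_char] := char_word q short_q.
exists [:: (w, true)]; split=> //; split.
  by move=> e; rewrite inE => /eqP -> /=; split=> // _; apply/qp.
move=> t [Pi_t not_prec] /(_ (w, true) (mem_head _ _)) [_ /(_ erefl) /= tw].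
have [r [Pi_r rt] le_rq] : exists2 r, Pi r /\ same_lang r t & size r <= size q.
  apply: NNPP => no_short; apply: not_prec.
  exists q; first by split=> //; apply: short_q.1.
  move=> u Pi_u ut; rewrite ltnNge; apply/negP => le_uq.
  by apply: no_short; exists u.
apply: same_lang_trans (same_lang_sym rt) _; apply: same_lang_trans qp.
by apply: w_char => //; apply/rt.
Qed.

End Teaching.

Section VariablePatterns.

Variable Sigma : countType.
Implicit Types (s r : seq nat) (w : word Sigma).

Definition var_pattern s : pattern Sigma := map inl s.

Lemma inL_var_pattern s w :
  inL (var_pattern s) w <-> exists h, w = flat_map h s.
Proof. by split=> -[h ->]; exists h; rewrite /subst /var_pattern -map_comp. Qed.

Lemma inL_flat_map (f : nat -> seq nat) s w :
  inL (var_pattern (flat_map f s)) w -> inL (var_pattern s) w.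
Proof.
move=> /inL_var_pattern [h ->]; apply/inL_var_pattern.
by exists (fun x => flat_map h (f x)); rewrite flat_map_comp.
Qed.

Lemma constant_freeP (p : pattern Sigma) :
  constant_free p -> exists s, p = var_pattern s.
Proof.
elim: p => [|[x|a] p IHp] //=; first by exists [::].
by move=> /IHp [s ->]; exists (x :: s).
Qed.

Lemma QRcf_var_pattern m s :
  QRcf m (var_pattern s) <-> s != [::] /\ regular m s.
Proof.
have count_var x : count_mem (inl x) (var_pattern s) = count_mem x s.
  by rewrite count_map; apply: eq_count.
have neq0 : (var_pattern s != [::]) = (s != [::]) by case: (s).
rewrite /QRcf neq0; split=> [[s0 _ /allP qr_s]|[s0 reg_s]]; split=> //.
- move=> x xs; have /qr_s /eqP : inl x \in var_pattern s by apply: map_f.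
  by rewrite count_var.
- by rewrite /constant_free all_map; apply/allP.
- by apply/allP => _ /mapP [x xs ->] /=; rewrite count_var reg_s.
Qed.

Lemma QRcfP m (p : pattern Sigma) : QRcf m p ->
  exists s, [/\ p = var_pattern s, s != [::] & regular m s].
Proof.
move=> QR_p; have [_ /constant_freeP [s ps] _] := QR_p; exists s.
by move: QR_p; rewrite ps => /QRcf_var_pattern [].
Qed.

Lemma same_lang_morphism_shortest m r (f : nat -> seq nat) :
    regular m r -> shortest (@QRcf Sigma m) (var_pattern (flat_map f r)) ->
    size r <= size (flat_map f r) ->
  same_lang (var_pattern r) (var_pattern (flat_map f r)).
Proof.
set q := flat_map f r => reg_r [/QRcf_var_pattern [q0 reg_q] min_q] le_rq.
pose r' := [seq y <- r | ~~ nilp (f y)].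
have fr' : flat_map f r' = q by apply: flat_map_filter_nilp.
have reg_r' : regular m r' by apply: regular_filter.
have [||g gE] := @uniq_flat_map_retraction _ _ f (undup r').
- by apply: regular_flat_map_uniq reg_r' _; rewrite fr'.
- by move=> y; rewrite mem_undup mem_filter => /andP [].
have gq : flat_map g q = r'.
  rewrite -fr' flat_map_comp; apply: flat_map_seq1_in => y yr'.
  by apply: gE; rewrite mem_undup.
have r'q : same_lang (var_pattern r') (var_pattern q).
  by move=> w; split; [rewrite -gq | rewrite -fr']; apply: inL_flat_map.
suff r'r : r' = r by move: r'q; rewrite r'r.
have r'0 : r' != [::] by apply: contraNneq q0 => r'0; rewrite -fr' r'0.
have /min_q /(_ r'q) : QRcf m (var_pattern r') by apply/QRcf_var_pattern.
rewrite !size_map => le_qr'; apply/all_filterP.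
by rewrite all_count eqn_leq count_size -size_filter (leq_trans le_rq).
Qed.

End VariablePatterns.

Lemma ex_transversal_avoiding (T U : eqType) (B : T -> seq U) (label : U -> T)
    (avoided : seq U) :
    (forall x, uniq (B x)) -> (forall x, {in B x, forall e, label e = x}) ->
    (forall x, size avoided < size (B x)) ->
  exists2 P : pred U,
    ~~ has P avoided & forall x, map label (filter P (B x)) = [:: x].
Proof.
move=> uniq_B labelE lt_avoided.
pose avoid x := [seq e <- B x | e \notin avoided].
have avoidP x : exists2 e, ohead (avoid x) = Some e & e \in avoid x.
  suff: has (predC (mem avoided)) (B x).
    rewrite has_filter -/(avoid x); case: (avoid x) => // e t _.
    by exists e; rewrite ?mem_head.
  rewrite has_predC; apply: contraL (lt_avoided x) => /allP sub_avoided.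
  by rewrite -leqNgt uniq_leq_size.
exists (fun e => ohead (avoid (label e)) == Some e) => [|x].
  apply/hasPn => e eE; have [e' ->] := avoidP (label e); rewrite mem_filter.
  by case/andP => e'_ok _; apply: contraNneq e'_ok => -[->].
have [e markE] := avoidP x; rewrite mem_filter => /andP [_ e_x].
rewrite (eq_in_filter (a2 := pred1 e)) => [|e' /labelE ->].
  by rewrite filter_pred1_uniq //= (labelE x).
by rewrite markE /= eq_sym.
Qed.

Section Runs.

Variables (T : eqType) (a b : T).
Implicit Types w : seq T.

(* The lengths of the maximal [a]-free factors of [w] that are followed by [a],
   [k] being added to the first one. *)
Fixpoint runs k w : seq nat :=
  if w is x :: w' then
    if x == a then k :: runs 0 w' else runs k.+1 w'
  else [::].

Lemma runs_cat k w :
  exists k', forall w', runs k (w ++ w') = runs k w ++ runs k' w'.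
Proof.
elim: w k => [|x w IHw] k /=; first by exists k.
by case: (x == a); [have [k' catE] := IHw 0 | have [k' catE] := IHw k.+1];
  exists k' => w'; rewrite catE.
Qed.

Lemma behead_runs k w : behead (runs k w) = behead (runs 0 w).
Proof.
elim: w k => //= x w IHw k; case: (x == a) => //.
by rewrite [LHS]IHw [RHS]IHw.
Qed.

Lemma runs_flat_map (U : Type) (g : U -> seq T) k s :
  exists2 cut, size cut <= size s & forall P : pred nat, ~~ has P cut ->
    filter P (runs k (flat_map g s))
      = flat_map (fun y => filter P (behead (runs 0 (g y)))) s.
Proof.
elim: s k => [|y s IHs] k; first by exists [::].
have [k' catE] := runs_cat k (g y); have [cut size_cut cut_filter] := IHs k'.
exists (take 1 (runs k (g y)) ++ cut) => [|P].
  by rewrite size_cat -[size (y :: s)]add1n leq_add // size_take_min geq_minl.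
rewrite has_cat negb_or => /andP [head_P cut_P].
rewrite !flat_map_cons catE filter_cat cut_filter // -(behead_runs k).
rewrite -[in LHS](cat_take_drop 1 (runs k (g y))) filter_cat drop1.
by move: head_P; rewrite has_filter negbK => /eqP ->.
Qed.

Hypothesis ab : a != b.

Definition block e : seq T := rcons (nseq e b) a.

Lemma runs_blocks s : runs 0 (flat_map block s) = s.
Proof.
have runs_block k e w : runs k (block e ++ w) = k + e :: runs 0 w.
  elim: e k => [|e IHe] k /=; first by rewrite eqxx addn0.
  by rewrite eq_sym (negPf ab) IHe addSnnS.
by elim: s => // e s IHs; rewrite flat_map_cons runs_block IHs.
Qed.

Definition code K x : seq T := flat_map block (iota (x * K) K).

Lemma morphism_of_code_factorisation (U : Type) K (s : seq nat) (r : seq U)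
    (g : U -> seq T) :
    size r < K -> flat_map (code K) s = flat_map g r ->
  exists f, s = flat_map f r.
Proof.
move=> lt_rK codeE.
have [cut size_cut cut_filter] := runs_flat_map g 0 r.
have [||x|P cut_P markE] :=
  @ex_transversal_avoiding _ _ (fun x => iota (x * K) K) (fun e => e %/ K) cut.
- by move=> x; apply: iota_uniq.
- move=> x e; rewrite mem_iota => /andP [le_e lt_e].
  have K_gt0 : 0 < K by apply: leq_ltn_trans lt_rK.
  by rewrite -(subnKC le_e) divnMDl // divn_small ?addn0 // ltn_subLR.
- by rewrite size_iota; apply: leq_ltn_trans lt_rK.
exists (fun y => [seq e %/ K | e <- filter P (behead (runs 0 (g y)))]).
rewrite -map_flat_map -cut_filter // -codeE -flat_map_comp runs_blocks.
by rewrite filter_flat_map map_flat_map flat_map_seq1_in.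
Qed.

End Runs.

Lemma QRcf_PBTD_le1 (Sigma : countType) m (a b : Sigma) :
  a != b -> PBTD_le (@QRcf Sigma m) 1.
Proof.
move=> ab; apply: PBTD_le1_shortest => p short_p.
have [q [pq _ _]] := QRcfP short_p.1; move: short_p; rewrite {p}pq => short_q.
exists (flat_map (code a b (size q).+1) q).
  by apply/inL_var_pattern; eexists.
move=> _ /QRcfP [r [-> _ reg_r]]; rewrite !size_map => le_rq.
move=> /inL_var_pattern [g codeE].
have [f qE] := morphism_of_code_factorisation ab (K := (size q).+1) le_rq codeE.
by move: short_q le_rq; rewrite qE; apply: same_lang_morphism_shortest.
Qed.

Lemma not_same_lang_nseq (Sigma : countType) m (a b : Sigma) :
    1 < m -> a != b ->
  ~ same_lang (var_pattern Sigma (nseq m 0))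
              (var_pattern Sigma (nseq m 0 ++ nseq m 1)).
Proof.
move=> m_gt1 ab same.
have /same /inL_var_pattern [g] :
    inL (var_pattern Sigma (nseq m 0 ++ nseq m 1)) (nseq m a ++ nseq m b).
  apply/inL_var_pattern; exists (fun x => [:: if x == 0 then a else b]).
  by rewrite /flat_map flatten_map1 map_cat !map_nseq.
rewrite /flat_map map_nseq; set u := g 0 => wE.
have size_u : size u = 2.
  apply/eqP; rewrite -(eqn_pmul2r (ltnW m_gt1)) mul2n -addnn.
  by have /eqP := congr1 size wE;
    rewrite size_cat !size_nseq size_flatten /shape map_nseq sumn_nseq eq_sym.
have u_aa : [:: a; a] = u.
  have := congr1 (take (size u)) wE; rewrite {1}size_u.
  case: m m_gt1 {same wE} => [|[|n]] // _.
  by rewrite (take_size_cat _ (erefl (size u))) /= take0 => <-.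
have /flattenP [v] : b \in flatten (nseq m u).
  by rewrite -wE mem_cat !mem_nseq eqxx (ltnW m_gt1) orbT.
rewrite mem_nseq => /andP [_ /eqP ->].
by rewrite -u_aa !inE orbb eq_sym (negPf ab).
Qed.

Lemma QRcf_PBTD_gt0 (Sigma : countType) m (a b : Sigma) :
  1 < m -> a != b -> ~ PBTD_le (@QRcf Sigma m) 0.
Proof.
move=> m_gt1 ab /PBTD_le0_same_lang same; apply: (not_same_lang_nseq m_gt1 ab).
apply: same; apply/QRcf_var_pattern; split.
- by case: m m_gt1.
- exact: regular_nseq.
- by case: m m_gt1.
apply: regular_cat; [|exact: regular_nseq..].
by apply/hasPn => x /nseqP [-> _]; rewrite /= mem_nseq andbF.
Qed.

Lemma inL_QRcf1 (Sigma : countType) (p : pattern Sigma) w : QRcf 1 p -> inL p w.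
Proof.
move=> /QRcfP [[|x s] [-> // _ reg_s]]; apply/inL_var_pattern.
exists (fun y => if y == x then w else [::]).
by rewrite (flat_map_if (pred1 x)) (reg_s x) ?mem_head //= cats0.
Qed.

Theorem mainTheorem9 :
  (forall Sigma : countType, inhabited Sigma ->
     TD_eq (@QRcf Sigma 1) 0 /\ PBTD_eq (@QRcf Sigma 1) 0) /\
  (forall (Sigma : countType) (m : nat), 2 <= m ->
     (exists f : 'I_(4 * m ^ 2 + 1) -> Sigma, injective f) ->
     PBTD_eq (@QRcf Sigma m) 1).
Proof.
split=> [Sigma _|Sigma m m_gt1 [f inj_f]].
  have TD0 : TD_le (@QRcf Sigma 1) 0.
    by apply: TD_le0 => p q QR_p QR_q w; split=> _; apply: inL_QRcf1.
  by split; split=> //; apply: TD_le_PBTD_le.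
have lt1 : 1 < 4 * m ^ 2 + 1.
  by rewrite addn1 ltnS muln_gt0 expn_gt0 (ltnW m_gt1).
pose a := f (Ordinal (ltnW lt1)); pose b := f (Ordinal lt1).
have ab : a != b by apply/eqP => /inj_f.
split; first exact: QRcf_PBTD_le1 ab.
by case=> // _; apply: QRcf_PBTD_gt0 m_gt1 ab.
Qed.
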